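(* For $k=3/2$ and every real $\mu\ge0$, $$\mu^{2k-2}\sum_{n=1}^\infty\frac{2n+1}{\bigl(n(n+1)+\mu^2\bigr)^k}<\frac1{k-1}.$$ *)

(* Defs.v *)
From mathcomp Require Export all_boot all_order all_algebra.
From mathcomp Require Export all_classical all_reals all_analysis.

Set Implicit Arguments.
Unset Strict Implicit.
Unset Printing Implicit Defensive.

Import Order.TTheory GRing.Theory Num.Theory.
Import numFieldNormedType.Exports.
Local Open Scope ring_scope.

Definition summand {R : realType} (k mu : R) (n : nat) : R :=
  (2 * n%:R + 1) / (n%:R * (n%:R + 1) + mu ^+ 2) `^ k.

(* Main.v *)
Require Import Defs.
From mathcomp Require Import all_boot all_order all_algebra.
From mathcomp Require Import all_classical all_reals all_analysis.
From mathcomp Require Import ring lra.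

Import Order.TTheory GRing.Theory Num.Theory.
Import numFieldNormedType.Exports.
Local Open Scope classical_set_scope.
Local Open Scope ring_scope.

(** The numerator [2 n + 1] is the length of the interval
    [[n ^ 2 + c, (n + 1) ^ 2 + c]], and for [c = mu ^ 2 - 1 / 2] the midpoint of
    this interval is exactly [n (n + 1) + mu ^ 2].  The series is therefore the
    midpoint-rule sum of the convex function [x ^ (- 3 / 2)] over consecutive
    intervals that tile [[mu ^ 2 + 1 / 2, +oo[], a range of positive numbers because
    the series starts at [n = 1].  The midpoint rule
    underestimates the integral of a convex function
    ([midpoint_powR32_le], the Hermite-Hadamard inequality), so the series is at
    most the integral of [x ^ (- 3 / 2)] from [mu ^ 2 + 1 / 2] to infinity,
    which is [2 / sqrt (mu ^ 2 + 1 / 2)].  Multiplied by [mu], this is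
    [2 mu / sqrt (mu ^ 2 + 1 / 2) < 2]. *)

Lemma powR32 (R : realType) (x : R) : 0 <= x -> x `^ (3 / 2) = Num.sqrt x ^+ 3.
Proof.
move=> x0; have -> : 3 / 2 = 2^-1 * 3%:R :> R by field.
by rewrite powRrM powR12_sqrt // powR_mulrn // sqrtr_ge0.
Qed.

(** Hermite-Hadamard for the convex function [x ^ (- 3 / 2)]: the right-hand
    side is its integral over [[u, v]].  With [p = sqrt u], [q = sqrt v] and
    [s] the square root of the midpoint, so that [2 s ^ 2 = p ^ 2 + q ^ 2], it
    reduces to [p q (p + q) <= 2 s ^ 3], a product of the two mean inequalities
    [p q <= s ^ 2] and [p + q <= 2 s]. *)
Lemma midpoint_powR32_le (R : realType) (u v : R) : 0 < u -> u <= v ->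
  (v - u) / ((u + v) / 2) `^ (3 / 2) <= 2 / Num.sqrt u - 2 / Num.sqrt v.
Proof.
move=> u0 uv; have v0 : 0 < v := lt_le_trans u0 uv.
have m0 : 0 < (u + v) / 2 by lra.
rewrite (powR32 _ _ (ltW m0)).
have p0 : 0 < Num.sqrt u by rewrite sqrtr_gt0.
have q0 : 0 < Num.sqrt v by rewrite sqrtr_gt0.
have s0 : 0 < Num.sqrt ((u + v) / 2) by rewrite sqrtr_gt0.
have pE : Num.sqrt u ^+ 2 = u by rewrite sqr_sqrtr ?ltW.
have qE : Num.sqrt v ^+ 2 = v by rewrite sqr_sqrtr ?ltW.
have sE : Num.sqrt ((u + v) / 2) ^+ 2 = (u + v) / 2 by rewrite sqr_sqrtr ?ltW.
have pq : Num.sqrt u <= Num.sqrt v by rewrite ler_wsqrtr.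
move: p0 q0 s0 pE qE sE pq.
set p := Num.sqrt u; set q := Num.sqrt v; set s := Num.sqrt _.
move=> p0 q0 s0 pE qE sE pq.
have sE2 : 2 * s ^+ 2 = p ^+ 2 + q ^+ 2 by lra.
have pqs : p * q <= s ^+ 2 by have := sqr_ge0 (p - q); lra.
have pDq : p + q <= 2 * s.
  have [pD0 s20] : 0 <= p + q /\ 0 <= 2 * s by split; lra.
  by rewrite -ler_sqr ?nnegrE//; have := sqr_ge0 (p - q); lra.
have pqDs : p * q * (p + q) <= 2 * s ^+ 3.
  have -> : 2 * s ^+ 3 = s ^+ 2 * (2 * s) by ring.
  by rewrite ler_pM // ?mulr_ge0 ?addr_ge0 ?ltW.
rewrite -pE -qE ler_pdivrMr ?exprn_gt0//.
have -> : (2 / p - 2 / q) * s ^+ 3 = (q - p) / (p * q) * (2 * s ^+ 3).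
  by field; rewrite !gt_eqF.
have -> : q ^+ 2 - p ^+ 2 = (q - p) / (p * q) * (p * q * (p + q)).
  by field; rewrite !gt_eqF.
by rewrite ler_wpM2l// divr_ge0 ?subr_ge0// mulr_ge0 ?ltW.
Qed.

Lemma summand32_le (R : realType) (mu : R) (n : nat) : (0 < n)%N ->
  summand (3 / 2) mu n <= 2 / Num.sqrt (n%:R ^+ 2 + mu ^+ 2 - 1 / 2)
                        - 2 / Num.sqrt (n.+1%:R ^+ 2 + mu ^+ 2 - 1 / 2).
Proof.
move=> n0; have n1 : 1 <= n%:R :> R by rewrite ler1n.
have mu2 := sqr_ge0 mu.
set u := n%:R ^+ 2 + _ - _; set v := n.+1%:R ^+ 2 + _ - _.
have vE : v = u + (2 * n%:R + 1) by rewrite /v /u -natr1; ring.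
have u0 : 0 < u by rewrite /u; nra.
have uv : u <= v by rewrite vE; lra.
apply: le_trans (midpoint_powR32_le _ _ _ u0 uv).
have -> : v - u = 2 * n%:R + 1 by rewrite vE; ring.
have -> : (u + v) / 2 = n%:R * (n%:R + 1) + mu ^+ 2 by rewrite vE /u; field.
exact: lexx.
Qed.

Lemma summand_ge0 (R : realType) (k mu : R) (n : nat) : 0 <= summand k mu n.
Proof. by rewrite /summand divr_ge0 ?powR_ge0// addr_ge0// mulr_ge0. Qed.

Lemma sum_summand32_le (R : realType) (mu : R) (N : nat) :
  \sum_(1 <= n < N) summand (3 / 2) mu n <= 2 / Num.sqrt (mu ^+ 2 + 1 / 2).
Proof.
have [N1|N1] := leqP N 1.
  by rewrite big_geq// divr_ge0 ?sqrtr_ge0.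
pose F n : R := - (2 / Num.sqrt (n%:R ^+ 2 + mu ^+ 2 - 1 / 2)).
have le_F : \sum_(1 <= n < N) summand (3 / 2) mu n
    <= \sum_(1 <= n < N) (F n.+1 - F n).
  rewrite big_nat [leRHS]big_nat; apply: ler_sum => n /andP[n0 _].
  by apply: le_trans (summand32_le _ mu n n0) _; rewrite /F opprK addrC.
apply: (le_trans le_F); rewrite telescope_sumr ?(ltnW N1)// /F opprK.
have -> : 1%:R ^+ 2 + mu ^+ 2 - 1 / 2 = mu ^+ 2 + 1 / 2 :> R by field.
by rewrite gerDr oppr_le0 divr_ge0 ?sqrtr_ge0.
Qed.

Theorem proposition4p1 (R : realType) (k mu : R) (hk : k = 3 / 2)
    (hmu : 0 <= mu) :
  cvgn (fun N : nat => \sum_(1 <= n < N) summand k mu n) /\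
  mu `^ (2 * k - 2) * limn (fun N : nat => \sum_(1 <= n < N) summand k mu n) < 1 / (k - 1).
Proof.
subst k; set S := fun N : nat => _.
have S_nd : nondecreasing_seq S.
  apply/nondecreasing_seqP => -[|n]; rewrite /S; first by rewrite !big_geq.
  by rewrite [leRHS]big_nat_recr//= lerDl summand_ge0.
have S_cvg : cvgn S.
  apply: nondecreasing_is_cvgn => //.
  by exists (2 / Num.sqrt (mu ^+ 2 + 1 / 2)) => _ [N _ <-]; exact: sum_summand32_le.
have limS : limn S <= 2 / Num.sqrt (mu ^+ 2 + 1 / 2).
  by apply: limr_le => //; apply: nearW => N; exact: sum_summand32_le.
split=> //.
have -> : 2 * (3 / 2) - 2 = 1 :> R by field.
have -> : 1 / (3 / 2 - 1) = 2 :> R by field.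
rewrite powRr1//; apply: (le_lt_trans (ler_wpM2l hmu limS)).
have r0 : 0 < mu ^+ 2 + 1 / 2 by have := sqr_ge0 mu; lra.
rewrite mulrA ltr_pdivrMr ?sqrtr_gt0// mulrC ltr_pM2l//.
by rewrite -[ltLHS](ger0_norm hmu) -sqrtr_sqr ltr_sqrt//; lra.
Qed.
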